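(* Let $R$ be a strongly NUS-nil clean ring. Then the Jacobson radical $J(R)$ is a nil ideal of $R$.
   Context: All rings are associative with identity, not necessarily commutative. An ideal is nil if all of its elements are nilpotent. An element $e\in R$ is square-idempotent if $e^2=e^4$. An element $a\in R$ is strongly square-nil clean if $a=e+n$ with $e\in R$ square-idempotent, $n\in R$ nilpotent and $en=ne$. A ring $R$ is strongly NUS-nil clean if every non-invertible element of $R$ is strongly square-nil clean. *)

(* Defs.v *)
From HB Require Import structures.
From mathcomp Require Import all_boot all_algebra.
From mathcomp Require Import boolp classical_sets.

Set Implicit Arguments.
Unset Strict Implicit.
Unset Printing Implicit Defensive.

Import GRing.Theory.
Local Open Scope ring_scope.
Local Open Scope classical_set_scope.

(* Rings are pzRingType's: associative with identity, possibly noncommutative,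
   the zero ring being allowed.  Invertibility is two-sided and stated in Prop,
   so that no decidability of units (unitRingType) is required of the ring. *)
Definition invertible (R : pzRingType) (a : R) : Prop :=
  exists b : R, a * b = 1 /\ b * a = 1.

Definition nilpotent_elt (R : pzRingType) (a : R) : Prop :=
  exists k : nat, a ^+ k = 0.

Definition square_idempotent (R : pzRingType) (e : R) : Prop :=
  e ^+ 2 = e ^+ 4.

Definition strongly_square_nil_clean (R : pzRingType) (a : R) : Prop :=
  exists e n : R, [/\ a = e + n, square_idempotent e, nilpotent_elt n
                    & e * n = n * e].

Definition strongly_NUS_nil_clean (R : pzRingType) : Prop :=
  forall a : R, ~ invertible a -> strongly_square_nil_clean a.

(* Closure under opposite follows, as - x = (- 1) * x. *)
Definition left_ideal (R : pzRingType) (I : set R) : Prop :=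
  [/\ I 0, forall x y, I x -> I y -> I (x + y)
    & forall r x, I x -> I (r * x)].

Definition two_sided_ideal (R : pzRingType) (I : set R) : Prop :=
  left_ideal I /\ forall r x, I x -> I (x * r).

Definition maximal_left_ideal (R : pzRingType) (M : set R) : Prop :=
  [/\ left_ideal M, M <> setT
    & forall I : set R, left_ideal I -> M `<=` I -> I = M \/ I = setT].

(* The whole ring when R is the zero ring (empty intersection). *)
Definition jacobson_radical (R : pzRingType) : set R :=
  \bigcap_(M in [set M : set R | maximal_left_ideal M]) M.

Definition nil_ideal (R : pzRingType) (I : set R) : Prop :=
  two_sided_ideal I /\ forall x, I x -> nilpotent_elt x.

Arguments strongly_NUS_nil_clean : clear implicits.
Arguments jacobson_radical : clear implicits.

(* Main.v *)
Require Import Defs.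
From HB Require Import structures.
From mathcomp Require Import all_boot all_algebra.
From mathcomp Require Import boolp classical_sets.

(** An element [a = e + n] that is strongly square-nil clean satisfies
    [a ^+ 2 = a ^+ 4] up to a nilpotent, because [a] and [e] differ by the
    nilpotent [n], which commutes with both; hence [(1 - a ^+ 2) * a ^+ 2] is
    nilpotent ([square_nil_clean_nilpotent]).  If [a] lies in the Jacobson
    radical, [1 - a ^+ 2] is left invertible and can be cancelled from a power
    of this product, so [a] is nilpotent.  The hypothesis on the ring covers
    all [a] except the invertible ones, and the radical contains an invertible
    element only if the ring is zero, where everything is nilpotent.

    Since the radical is the intersection of the maximal left ideals, two
    classical facts are proved about it: it is closed under multiplication on
    the right ([jacobson_mulr]), because the preimage of a maximal left ideal
    under right multiplication by [r] is maximal or the whole ring; and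
    [1 - y] is left invertible for [y] in it ([jacobson_left_inv]), because
    otherwise Zorn's lemma puts [1 - y], and then [1], in some maximal left
    ideal. *)

Set Implicit Arguments.
Unset Strict Implicit.
Unset Printing Implicit Defensive.

Import GRing.Theory.
Local Open Scope ring_scope.
Local Open Scope classical_set_scope.

Section JacobsonRadical.
Variable R : pzRingType.
Implicit Types (I L M A : set R) (a e n r u v x y : R).

Lemma left_ideal1 I : left_ideal I -> I 1 -> I = setT.
Proof.
move=> [_ _ IM] I1; apply/seteqP; split=> // x _.
by rewrite -[x]mulr1; apply: IM.
Qed.

Lemma maximal_left_ideal_proper M : maximal_left_ideal M -> ~ M 1.
Proof. by move=> [LM MT _] /(left_ideal1 LM). Qed.

Lemma left_ideal_principal_add I x :
  left_ideal I -> left_ideal [set z | exists r, I (z - r * x)].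
Proof.
move=> [I0 ID IM]; split.
- by exists 0; rewrite mul0r subr0.
- move=> a b [r Ir] [s Is]; exists (r + s).
  by rewrite mulrDl opprD addrACA; apply: ID.
- move=> t a [r Ir]; exists (t * r).
  by rewrite -mulrA -mulrBr; apply: IM.
Qed.

Lemma maximal_left_ideal_add M x : maximal_left_ideal M -> ~ M x ->
  forall z, exists r, M (z - r * x).
Proof.
move=> [LM _ Mmax] nMx z.
have [M0 _ _] := LM.
have sM : M `<=` [set z | exists r, M (z - r * x)].
  by move=> y My; exists 0; rewrite mul0r subr0.
case: (Mmax _ (left_ideal_principal_add x LM) sM) => [EM|ET].
- by exfalso; apply: nMx; rewrite -EM; exists 1; rewrite mul1r subrr.
- by have : [set: R] z by []; rewrite -ET.
Qed.

(** If [a * r] is outside [M], then [r] equals [s * (a * r)] modulo [M] for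
    some [s], so that [1 - s * a] is in the preimage of [M]: any left ideal
    containing the preimage and [a] contains [1]. *)
Lemma maximal_left_ideal_preim_mulr M r : maximal_left_ideal M -> ~ M r ->
  maximal_left_ideal [set a | M (a * r)].
Proof.
move=> maxM nMr; have [[M0 MD MM] _ _] := maxM; split.
- split=> /=; first by rewrite mul0r.
  + by move=> x y Mx My; rewrite mulrDl; apply: MD.
  + by move=> s x Mx; rewrite -mulrA; apply: MM.
- move=> E; apply: nMr; rewrite -[r]mul1r.
  by have : [set: R] 1 by []; rewrite -E.
move=> I LI sI.
have [sI'|/existsNP[a /not_implyP[Ia nMa]]] :=
  pselect (I `<=` [set a | M (a * r)]).
  by left; apply/seteqP; split.
right; apply: (left_ideal1 LI).
have [s] := maximal_left_ideal_add maxM nMa r.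
rewrite mulrA -[X in X - _]mul1r -mulrBl => /sI I1sa.
have [_ ID IM] := LI.
by rewrite -(subrK (s * a) 1); apply: ID => //; apply: IM.
Qed.

Lemma jacobson_mulr r x : jacobson_radical R x -> jacobson_radical R (x * r).
Proof.
move=> Jx M maxM; have [[_ _ MM] _ _] := maxM.
have [Mr|nMr] := pselect (M r); first exact: MM.
exact: (Jx _ (maximal_left_ideal_preim_mulr maxM nMr)).
Qed.

Lemma jacobson_two_sided : two_sided_ideal (jacobson_radical R).
Proof.
split; last by move=> r x; apply: jacobson_mulr.
split.
- by move=> M [[]].
- by move=> x y Jx Jy M maxM; have [[_ MD _] _ _] := maxM; apply: MD;
    [apply: Jx|apply: Jy].
- by move=> r x Jx M maxM; have [[_ _ MM] _ _] := maxM; apply: MM; apply: Jx.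
Qed.

Lemma exists_maximal_left_ideal L : left_ideal L -> ~ L 1 ->
  exists2 M, maximal_left_ideal M & L `<=` M.
Proof.
move=> LL nL1.
(* Zorn_bigcup also asks for the union of the empty chain, which is set0 and
   not an ideal.  It is applied to the sets A for which L `|` A is a proper
   left ideal, where set0 stands for L. *)
pose P A := left_ideal (L `|` A) /\ ~ (L `|` A) 1.
have P0 : P set0 by rewrite /P setU0.
have [F FP Ftot|A [[LA nA1] Amax]] := @Zorn_bigcup R P.
  set U := \bigcup_(X in F) X.
  have inP x : (L `|` U) x ->
      exists2 X, (X = set0 \/ F X) & (L `|` X) x.
    case=> [Lx|[X FX Xx]]; first by exists set0; left.
    by exists X; right.
  have PX X : X = set0 \/ F X -> P X by case=> [->|/FP].
  have subU X : X = set0 \/ F X -> L `|` X `<=` L `|` U.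
    by case=> [->|FX] y [Ly|Xy] //; [left|left|right; exists X].
  split; last by move=> /inP[X /PX[_]].
  split; first by left; case: LL.
  - move=> x y /inP[X FX Xx] /inP[Y FY Yy].
    have [XY|YX] : X `<=` Y \/ Y `<=` X.
      case: FX => [->|FX]; first by left.
      by case: FY => [->|FY]; [right|apply: Ftot].
    + have [[_ YD _] _] := PX _ FY; apply: (subU _ FY); apply: YD => //.
      by case: Xx => [|/XY]; [left|right].
    + have [[_ XD _] _] := PX _ FX; apply: (subU _ FX); apply: XD => //.
      by case: Yy => [|/YX]; [left|right].
  - move=> r x /inP[X FX Xx]; have [[_ _ XM] _] := PX _ FX.
    by apply: (subU _ FX); apply: XM.
exists (L `|` A); last by move=> x; left.
split=> //; first by move=> E; apply: nA1; rewrite E.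
move=> I LI sI.
have [I1|nI1] := pselect (I 1); first by right; apply: left_ideal1.
left; apply/seteqP; split=> // x Ix.
have LUI : L `|` I = I by apply/setUidr => y Ly; apply: sI; left.
apply: contrapT => nx; apply: (Amax I); last by rewrite /P LUI.
split; first by move=> y Ay; apply: sI; right.
by move=> IA; apply: nx; right; apply: IA.
Qed.

(** The left ideal generated by [1 - y] is proper if [1 - y] has no left
    inverse; a maximal left ideal above it would contain [y] and [1 - y]. *)
Lemma jacobson_left_inv y :
  jacobson_radical R y -> exists b, b * (1 - y) = 1.
Proof.
move=> Jy; apply: contrapT => nb.
have LP : left_ideal [set z | exists b, b * (1 - y) = z].
  split; first by exists 0; rewrite mul0r.
  - by move=> _ _ [a <-] [b <-]; exists (a + b); rewrite mulrDl.
  - by move=> r _ [a <-]; exists (r * a); rewrite mulrA.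
have [M maxM sM] := exists_maximal_left_ideal LP nb.
have [[_ MD _] _ _] := maxM.
apply: (maximal_left_ideal_proper maxM).
rewrite -(subrK y 1); apply: MD; last exact: Jy.
by apply: sM; exists 1; rewrite mul1r.
Qed.

Lemma left_inv_cancel_nilpotent b u v : b * u = 1 -> GRing.comm u v ->
  nilpotent_elt (u * v) -> nilpotent_elt v.
Proof.
move=> bu uv [k uvk]; exists k.
have cancel m w : u ^+ m * w = 0 -> w = 0.
  elim: m w => [|m IH] w; first by rewrite mul1r.
  rewrite exprSr -mulrA => /IH uw.
  by rewrite -[w]mul1r -bu -mulrA uw mulr0.
by apply: (cancel k); rewrite -exprMn_comm.
Qed.

(** Both [a ^+ 2 - e ^+ 2] and [a ^+ 4 - e ^+ 4] are multiples of [n] by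
    elements commuting with [n], and their difference is
    [a ^+ 2 - a ^+ 4]. *)
Lemma square_nil_clean_nilpotent a : strongly_square_nil_clean a ->
  nilpotent_elt ((1 - a ^+ 2) * a ^+ 2).
Proof.
move=> [e [n [aE e24 [k nk] en]]].
have na : GRing.comm n a by rewrite aE; apply: commrD.
have ea : GRing.comm a e by rewrite aE; apply/commr_sym/commrD.
have an : a - e = n by rewrite aE addrC addKr.
have quot m : exists2 q, a ^+ m - e ^+ m = n * q & GRing.comm n q.
  rewrite (subrXX_comm _ ea) an; eexists; first by [].
  by apply: commr_sum => i _; apply: commrM; apply: commrX.
have [q2 E2 c2] := quot 2; have [q4 E4 c4] := quot 4.
have -> : (1 - a ^+ 2) * a ^+ 2 = n * (q2 - q4).
  rewrite mulrBr -E2 -E4 -e24 mulrBl mul1r -exprD.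
  by rewrite opprB addrA subrK.
by exists k; rewrite exprMn_comm ?nk ?mul0r //; apply: commrB.
Qed.

Lemma jacobson_invertible_zero_ring x :
  jacobson_radical R x -> invertible x -> 1 = 0 :> R.
Proof.
move=> Jx [b [xb _]].
have [c] : exists c, c * (1 - x * b) = 1.
  by apply: jacobson_left_inv; apply: jacobson_mulr.
by rewrite xb subrr mulr0.
Qed.

End JacobsonRadical.

Theorem lemma2p9 (R : pzRingType) (HR : strongly_NUS_nil_clean R) :
  nil_ideal (jacobson_radical R).
Proof.
split; first exact: jacobson_two_sided.
move=> x Jx.
have [/(jacobson_invertible_zero_ring Jx) R0|/HR xclean] :=
  pselect (invertible x).
  by exists 0%N.
have [b bx] : exists b, b * (1 - x ^+ 2) = 1.
  by apply: jacobson_left_inv; rewrite expr2; apply: jacobson_mulr.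
have cx : GRing.comm (1 - x ^+ 2) (x ^+ 2).
  by apply/commr_sym/commrB; [apply: commr1|].
have [k xk] :=
  left_inv_cancel_nilpotent bx cx (square_nil_clean_nilpotent xclean).
by exists (2 * k)%N; rewrite exprM.
Qed.
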